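(* Let $V,W,Z$ be weak symplectic vector spaces and let $L_1\subseteq\overline V\oplus W$ and $L_2\subseteq\overline W\oplus Z$ be split canonical relations which are neatly related. Then the composition $L_2\circ L_1=\{(v,z)\in V\oplus Z : \exists\, w\in W,\ (v,w)\in L_1,\ (w,z)\in L_2\}$ is a split canonical relation from $V$ to $Z$, i.e. a split Lagrangian subspace of $\overline V\oplus Z$.
   Context: All vector spaces are real topological vector spaces, and $V^*$ denotes the space of continuous linear functionals on $V$. A weak symplectic vector space is a space $V$ with a skew-symmetric bilinear form $\omega$ such that $\omega^\sharp(v)=\omega(v,\cdot)$ defines an injective linear map $\omega^\sharp:V\to V^*$. For a subspace $S$, $S^\omega$ is its orthogonal with respect to $\omega$. A subspace $L$ is isotropic if $L\subseteq L^\omega$, coisotropic if $L^\omega\subseteq L$, Lagrangian if $L=L^\omega$, and split Lagrangian if it is Lagrangian and has a Lagrangian complement; a pair $(L,L')$ of complementary Lagrangian subspaces is a splitting l-pair. $\overline V$ denotes $V$ with the form $-\omega$, and direct sums carry the direct sum of the forms. A split canonical relation $L:V\nrightarrow W$ is a split Lagrangian subspace of $\overline V\oplus W$. A coisotropic subspace $C$ of a weak symplectic space $U$ is split coisotropic if there are a complement $C^c$ to $C$ in $U$ and a complement $C'$ to $C^\omega$ in $C$ such that $C^c$ is isotropic and $C'$, $C^c$ are symplectically orthogonal; then $(C,C^c,C')$ is a splitting c-triple. A split Lagrangian subspace $L$ of $U$ and a split coisotropic $C$ intersect neatly if $C'=(L\cap C')+(L'\cap C')$ for some splitting l-pair $(L,L')$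 and some splitting c-triple $(C,C^c,C')$. Split canonical relations $L_1:V\nrightarrow W$ and $L_2:W\nrightarrow Z$ are neatly related if the split Lagrangian subspace $L_1\oplus L_2$ of $\overline V\oplus W\oplus\overline W\oplus Z$ and the subspace $V\oplus\Delta_W\oplus Z$ (which is split coisotropic), where $\Delta_W=\{(w,w):w\in W\}$, intersect neatly. *)

(* Defs.v *)
From HB Require Import structures.
From mathcomp Require Import all_boot all_algebra.
From mathcomp Require Import mathcomp_extra boolp classical_sets reals topology.
From mathcomp Require Import normedtype.

Set Implicit Arguments.
Unset Strict Implicit.
Unset Printing Implicit Defensive.

Import GRing.Theory Num.Theory.
Import numFieldNormedType.Exports.

Local Open Scope classical_set_scope.
Local Open Scope ring_scope.

(* The library makes [E * F] a topological vector space only when [E] and [F] *)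
(* are locally convex; this alias of [E * F], with the product topology and   *)
(* the pointwise operations, is one for arbitrary [E] and [F].                *)
Definition tprod (R : realType) (E F : topologicalLmodType R) : Type :=
  (E * F)%type.

Section tprod_topologicalLmodule.
Variables (R : realType) (E F : topologicalLmodType R).

HB.instance Definition _ := Topological.copy (tprod E F) (E * F)%type.
HB.instance Definition _ := GRing.Lmodule.copy (tprod E F) (E * F)%type.

Lemma tprod_add_continuous :
  continuous (fun x : tprod E F * tprod E F => x.1 + x.2).
Proof.
move => [/= xy1 xy2] /= U /= [] [A B] /= [nA nB] nU.
have [/= A0 [A01 A02] nA1] := @add_continuous E (xy1.1, xy2.1) _ nA.
have [/= B0 [B01 B02] nB1] := @add_continuous F (xy1.2, xy2.2) _ nB.
exists ([set xy | A0.1 xy.1 /\ B0.1 xy.2], [set xy | A0.2 xy.1 /\ B0.2 xy.2]).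
  by split; [exists (A0.1, B0.1)|exists (A0.2, B0.2)].
move => [[x1 y1][x2 y2]] /= [] [] a1 b1 [] a2 b2.
by apply: nU; split; [exact: (nA1 (x1, x2))|exact: (nB1 (y1, y2))].
Qed.

Lemma tprod_scale_continuous :
  continuous (fun z : R^o * tprod E F => z.1 *: z.2).
Proof.
move => [/= r [x y]] /= U /= []/= [A B] /= [nA nB] nU.
have [/= A0 [A01 A02] nA1] := @scale_continuous R E (r, x) _ nA.
have [/= B0 [B01 B02] nB1] := @scale_continuous R F (r, y) _ nB .
exists (A0.1 `&` B0.1, A0.2 `*` B0.2).
  by split; [exact: filterI|exists (A0.2,B0.2)].
by move=> [l [e f]] /= [] [Al Bl] [] Ae Be; apply: nU; split;
  [exact: (nA1 (l, e))|exact: (nB1 (l, f))].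
Qed.

HB.instance Definition _ := PreTopologicalNmodule_isTopologicalNmodule.Build
  (tprod E F) tprod_add_continuous.
HB.instance Definition _ := TopologicalNmodule_isTopologicalLmodule.Build
  R (tprod E F) tprod_scale_continuous.

End tprod_topologicalLmodule.

(* By bilinearity, [v |-> ws_form v] is a linear map into the linear          *)
(* functionals; [ws_form_continuous] says that its values lie in the          *)
(* continuous dual, and [ws_form_injective] that it is injective.             *)
Record weakSymplectic (R : realType) := WeakSymplectic {
  ws_space :> topologicalLmodType R;
  ws_form : {skew_symmetric ws_space};
  ws_form_continuous : forall v, continuous (ws_form v : ws_space -> R^o);
  ws_form_injective : injective (fun v => ws_form v : ws_space -> R)
}.

Arguments ws_form {R} _.

Definition opp_form (R : realType) (V : lmodType R) (f : V -> V -> R) :=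
  fun v v' => - f v v'.

Section opp_form_skew.
Variables (R : realType) (V : lmodType R) (f : {skew_symmetric V}).

Lemma opp_form_bilinear : bilinear_for
  (GRing.Scale.Law.clone _ _ *%R _)
  (GRing.Scale.Law.clone _ _ (idfun \; *%R) _) (opp_form f).
Proof.
split=> [v' a x y|v a x y]; rewrite /opp_form.
  by rewrite linearPl /= opprD mulrN.
by rewrite linearPr /= opprD mulrN.
Qed.

HB.instance Definition _ := bilinear_isBilinear.Build R V V R
  (GRing.Scale.Law.clone _ _ *%R _)
  (GRing.Scale.Law.clone _ _ (idfun \; *%R) _) (opp_form f) opp_form_bilinear.

Lemma opp_form_skew v v' :
  opp_form f v v' = (-1) ^+ true * idfun (opp_form f v' v).
Proof. by rewrite /opp_form (hermC f) /= mulrN. Qed.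

HB.instance Definition _ :=
  isHermitianSesquilinear.Build R V true idfun (opp_form f) opp_form_skew.

End opp_form_skew.

Section opp_weakSymplectic.
Variables (R : realType) (V : weakSymplectic R).

Lemma opp_form_continuous v : continuous (opp_form (ws_form V) v : V -> R^o).
Proof.
by move=> x; apply: (@cvgN R R^o V); exact: (@ws_form_continuous R V v x).
Qed.

Lemma opp_form_injective : injective (fun v => opp_form (ws_form V) v : V -> R).
Proof.
move=> v v' e; apply: (@ws_form_injective R V); apply/funext => x.
by apply: oppr_inj; exact: (congr1 (fun g => g x) e).
Qed.

Definition opp_weakSymplectic : weakSymplectic R :=
  @WeakSymplectic R V (opp_form (ws_form V)) opp_form_continuous
    opp_form_injective.

End opp_weakSymplectic.

Definition sum_form (R : realType) (V W : topologicalLmodType R)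
    (f : V -> V -> R) (g : W -> W -> R) : tprod V W -> tprod V W -> R :=
  fun x y => f x.1 y.1 + g x.2 y.2.

Section sum_form_skew.
Variables (R : realType) (V W : topologicalLmodType R).
Variables (f : {skew_symmetric V}) (g : {skew_symmetric W}).

Lemma sum_form_bilinear : bilinear_for
  (GRing.Scale.Law.clone _ _ *%R _)
  (GRing.Scale.Law.clone _ _ (idfun \; *%R) _) (sum_form f g).
Proof.
split=> [v' a x y|v a x y]; rewrite /sum_form /=.
  by rewrite !linearPl /= mulrDr addrACA.
by rewrite !linearPr /= mulrDr addrACA.
Qed.

HB.instance Definition _ := bilinear_isBilinear.Build R
  (tprod V W) (tprod V W) R
  (GRing.Scale.Law.clone _ _ *%R _)
  (GRing.Scale.Law.clone _ _ (idfun \; *%R) _) (sum_form f g)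
  sum_form_bilinear.

Lemma sum_form_skew x y :
  sum_form f g x y = (-1) ^+ true * idfun (sum_form f g y x).
Proof. by rewrite /sum_form (hermC f) (hermC g) /= mulrDr. Qed.

HB.instance Definition _ := isHermitianSesquilinear.Build R (tprod V W)
  true idfun (sum_form f g) sum_form_skew.

End sum_form_skew.

Section sum_weakSymplectic.
Variables (R : realType) (V W : weakSymplectic R).

Let E := tprod V W.
Let f : E -> E -> R := sum_form (ws_form V) (ws_form W).

Lemma sum_form_continuous v : continuous (f v : E -> R^o).
Proof.
move=> x; apply: (@cvgD R R^o E).
  apply: (@continuous_comp E V R^o fst (ws_form V v.1)); first exact: cvg_fst.
  exact: ws_form_continuous.
apply: (@continuous_comp E W R^o snd (ws_form W v.2)); first exact: cvg_snd.
exact: ws_form_continuous.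
Qed.

Lemma sum_form_injective : injective (fun v => f v : E -> R).
Proof.
move=> [v w] [v' w'] e; congr pair.
  apply: (@ws_form_injective R V); apply/funext => x.
  have := congr1 (fun h : E -> R => h (x, 0)) e.
  by rewrite /f /sum_form /= !linear0r !addr0.
apply: (@ws_form_injective R W); apply/funext => x.
have := congr1 (fun h : E -> R => h (0, x)) e.
by rewrite /f /sum_form /= !linear0r !add0r.
Qed.

Definition sum_weakSymplectic : weakSymplectic R :=
  @WeakSymplectic R (tprod V W) (sum_form (ws_form V) (ws_form W))
    sum_form_continuous sum_form_injective.

End sum_weakSymplectic.

Section subspaces.
Variables (R : realType) (U : lmodType R).
Implicit Types A B S T : set U.

Definition lin_subspace S := GRing.submod_closed [in S].

Definition sum_set A B : set U := [set a + b | a in A & b in B].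

(* Algebraic: no topological condition is put on the decomposition. Both      *)
(* summands lie in [T], since they contain 0.                                 *)
Definition complement_in T A B :=
  [/\ lin_subspace A, lin_subspace B, A `&` B = [set 0] & sum_set A B = T].

End subspaces.

Section symplectic_subspaces.
Variables (R : realType) (U : weakSymplectic R).
Implicit Types C L S : set U.

Definition orth S : set U := [set u | forall s, S s -> ws_form U u s = 0].

Definition isotropic S := lin_subspace S /\ S `<=` orth S.

Definition coisotropic C := lin_subspace C /\ orth C `<=` C.

Definition lagrangian L := lin_subspace L /\ L = orth L.

Definition splitting_lpair L L' :=
  [/\ lagrangian L, lagrangian L' & complement_in setT L L'].

Definition split_lagrangian L := exists L', splitting_lpair L L'.

Definition splitting_ctriple C Cc C' :=
  [/\ coisotropic C, complement_in setT C Cc, complement_in C (orth C) C',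
      isotropic Cc & C' `<=` orth Cc].

Definition split_coisotropic C := exists Cc C', splitting_ctriple C Cc C'.

Definition intersect_neatly L C :=
  [/\ split_lagrangian L, split_coisotropic C &
      exists L' Cc C', [/\ splitting_lpair L L', splitting_ctriple C Cc C' &
        C' = sum_set (L `&` C') (L' `&` C')]].

End symplectic_subspaces.

Definition split_canonical_relation (R : realType) (V W : weakSymplectic R)
    (L : set (V * W)) :=
  @split_lagrangian R (sum_weakSymplectic (opp_weakSymplectic V) W) L.

Arguments split_canonical_relation {R} V W L.

(* An element of the fourfold sum is written ((v, w), (w', z)).               *)
Definition neatly_related (R : realType) (V W Z : weakSymplectic R)
    (L1 : set (V * W)) (L2 : set (W * Z)) :=
  @intersect_neatly R
    (sum_weakSymplectic (sum_weakSymplectic (opp_weakSymplectic V) W)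
                        (sum_weakSymplectic (opp_weakSymplectic W) Z))
    (L1 `*` L2)
    [set x : (V * W) * (W * Z) | x.1.2 = x.2.1].

Arguments neatly_related {R} V W Z L1 L2.

Definition relation_comp (V W Z : Type)
    (L2 : set (W * Z)) (L1 : set (V * W)) : set (V * Z) :=
  [set x | exists w, L1 (x.1, w) /\ L2 (w, x.2)].

(* Main.v *)
Require Import Defs.
From mathcomp Require Import all_boot all_algebra.
From mathcomp Require Import classical_sets reals topology normedtype.
From mathcomp Require Import boolp.

(* Projecting [(v, w, w, z)] to [(v, z)] identifies the symplectic reduction  *)
(* of C = V + Delta_W + Z with V + Z, and C' with a section of it.            *)
(* Neatness makes the images A, B of L `&` C' and L' `&` C' isotropic         *)
(* subspaces spanning V + Z; nondegeneracy then forces (A, B) to be a         *)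
(* splitting l-pair.  The image of L `&` C, which is the composition, is      *)
(* isotropic and contains A, so it equals A, as Lagrangian subspaces are      *)
(* maximal isotropic.                                                         *)

Set Implicit Arguments.
Unset Strict Implicit.
Unset Printing Implicit Defensive.

Import GRing.Theory.

Local Open Scope classical_set_scope.
Local Open Scope ring_scope.

(** A weak form allows neither dimension counts nor [orth (orth S) = S], so the image of a
    Lagrangian subspace under reduction is a priori only isotropic. Neatness supplies a second
    isotropic subspace that together with it spans the reduced space, which is enough by
    [isotropic_spanning_lpair]. [neat_reduction] carries this out for any linear [p] that maps [C]
    onto [Y], preserves the form on [C] and kills [orth C]; the theorem is the case where [p]
    forgets the two middle coordinates. *)

Section subspaces.
Variables (R : realType) (U : lmodType R).

Lemma lin_subspaceP (S : set U) :
  lin_subspace S <-> S 0 /\ forall a u v, S u -> S v -> S (a *: u + v).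
Proof.
split=> -[S0 SP]; split; rewrite ?inE // in S0 *.
  by move=> a u v Su Sv; have := SP a u v; rewrite !inE; apply.
by move=> a u v; rewrite !inE; exact: SP.
Qed.

Lemma lin_subspaceI (S T : set U) :
  lin_subspace S -> lin_subspace T -> lin_subspace (S `&` T).
Proof.
move=> /lin_subspaceP[S0 SP] /lin_subspaceP[T0 TP]; apply/lin_subspaceP.
by split=> // a u v [Su Tu] [Sv Tv]; split; [exact: SP|exact: TP].
Qed.

Lemma complement_in_subr (T A B : set U) : complement_in T A B -> B `<=` T.
Proof.
move=> [/lin_subspaceP[A0 _] _ _ <-] b Bb.
by exists 0 => //; exists b => //; rewrite add0r.
Qed.

End subspaces.

Lemma lin_subspace_image (R : realType) (U Y : lmodType R) (p : U -> Y) (S : set U) :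
  linear p -> lin_subspace S -> lin_subspace (p @` S).
Proof.
move=> p_lin /lin_subspaceP[S0 SP]; apply/lin_subspaceP; split.
  by exists 0 => //; have := p_lin (-1) 0 0; rewrite scaler0 addr0 scaleN1r addNr.
move=> a _ _ [u Su <-] [v Sv <-]; exists (a *: u + v); first exact: SP.
exact: p_lin.
Qed.

Section symplectic.
Variables (R : realType) (U : weakSymplectic R).
Implicit Types A B L M : set U.

Lemma ws_form_eq0 (u : U) : (forall v, ws_form U u v = 0) -> u = 0.
Proof.
move=> u0; apply: (@ws_form_injective R U); apply/funext => v.
by rewrite /= u0 linear0l.
Qed.

Lemma isotropicS A B :
  lin_subspace A -> A `<=` B -> B `<=` orth B -> isotropic A.
Proof.
by move=> A_lin AB B_iso; split=> // u /AB/B_iso Bu v /AB; exact: Bu.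
Qed.

(** A vector orthogonal to both [A] and [B] is orthogonal to everything, hence zero. This gives the
    trivial intersection and the maximality of each summand. *)
Lemma isotropic_spanning_lpair A B :
  isotropic A -> isotropic B -> sum_set A B = setT -> splitting_lpair A B.
Proof.
have orth_orth A' B' u : sum_set A' B' = setT -> orth A' u -> orth B' u -> u = 0.
  move=> AB_T Au Bu; apply: ws_form_eq0 => v.
  have [a Aa [b Bb <-]] : sum_set A' B' v by rewrite AB_T.
  by rewrite linearDr /= Au // Bu // addr0.
have lagr A' B' :
    isotropic A' -> isotropic B' -> sum_set A' B' = setT -> lagrangian A'.
  move=> [A_lin A_iso] [B_lin B_iso] AB_T; split=> //.
  apply/seteqP; split=> // u Au.
  have [a Aa [b Bb ab_u]] : sum_set A' B' u by rewrite AB_T.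
  (* [b] is orthogonal to [A'] because [u] and [a] are, and to [B'] by isotropy. *)
  suff b0 : b = 0 by rewrite -ab_u b0 addr0.
  apply: (orth_orth _ _ _ AB_T); last exact: B_iso.
  move=> s As; have := Au s As.
  by rewrite -ab_u linearDl /= (A_iso a Aa s As) add0r.
have sumC A' B' : sum_set A' B' `<=` sum_set B' A'.
  by move=> _ [a Aa [b Bb <-]]; exists b => //; exists a => //; rewrite addrC.
move=> A_iso B_iso AB_T; split.
- exact: lagr AB_T.
- by apply: lagr B_iso A_iso _; apply/seteqP; split=> // u _; apply: sumC; rewrite AB_T.
have [[A_lin AoA] [B_lin BoB]] := (A_iso, B_iso); split=> //.
apply/seteqP; split=> [u [Au Bu]|_ ->].
  by apply: (orth_orth _ _ _ AB_T); [exact: AoA|exact: BoB].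
by split; [case/lin_subspaceP: A_lin|case/lin_subspaceP: B_lin].
Qed.

(** Orthogonals reverse inclusions: [M] lies in [orth M], hence in [orth L], which is [L]. *)
Lemma lagrangian_maximal L M :
  lagrangian L -> M `<=` orth M -> L `<=` M -> M = L.
Proof.
move=> [_ L_orth] M_iso LM; apply/seteqP; split=> // u /M_iso Mu.
by rewrite L_orth => s /LM; exact: Mu.
Qed.

End symplectic.

(* [p] presents [Y] as the symplectic reduction [C / orth C].                 *)
Lemma neat_reduction (R : realType) (U Y : weakSymplectic R) (p : U -> Y)
    (C L : set U) :
  linear p ->
  (forall x y, C x -> C y -> ws_form Y (p x) (p y) = ws_form U x y) ->
  p @` C = setT ->
  (forall x, orth C x -> p x = 0) ->
  intersect_neatly L C -> split_lagrangian (p @` (L `&` C)).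
Proof.
move=> p_lin p_form p_surj p_orth [_ _ [L' [Cc [C' [LL' CC'C neat]]]]].
have [[L_lin L_lag] [L'_lin L'_lag] _] := LL'.
have [_ _ C_split _ _] := CC'C.
have C'C := complement_in_subr C_split.
have [_ C'_lin _ C_sum] := C_split.
have image_iso (M : set U) : M = orth M -> p @` (M `&` C) `<=` orth (p @` (M `&` C)).
  move=> M_lag _ [x [Mx Cx] <-] _ [y [My Cy] <-].
  by rewrite p_form //; rewrite M_lag in Mx; exact: Mx.
have image_sub (M : set U) : p @` (M `&` C') `<=` p @` (M `&` C).
  by move=> _ [x [Mx /C'C Cx] <-]; exists x.
have image_isotropic (M : set U) :
    lin_subspace M -> M = orth M -> isotropic (p @` (M `&` C')).
  move=> M_lin M_lag; apply: isotropicS (image_sub M) (image_iso M M_lag).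
  by apply: lin_subspace_image => //; exact: lin_subspaceI.
have p_add x y : p (x + y) = p x + p y.
  by have := p_lin 1 x y; rewrite !scale1r.
have span : sum_set (p @` (L `&` C')) (p @` (L' `&` C')) = setT.
  apply/seteqP; split=> // y _.
  have [x Cx <-] : (p @` C) y by rewrite p_surj.
  (* The part [o] in [orth C] dies under [p]; neatness splits the part [c] in [C'] along [L] and
     [L']. *)
  move: Cx; rewrite -C_sum => -[o Oo [c C'c <-]].
  have [l lP [l' l'P <-]] : sum_set (L `&` C') (L' `&` C') c by rewrite -neat.
  rewrite p_add p_orth // add0r p_add.
  by exists (p l); [exists l|exists (p l') => //; exists l'].
have AB := isotropic_spanning_lpair (image_isotropic L L_lin L_lag)
  (image_isotropic L' L'_lin L'_lag) span.
exists (p @` (L' `&` C')).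
by have [A_lag _ _] := AB; rewrite (lagrangian_maximal A_lag (image_iso L L_lag)).
Qed.

Theorem theorem3p13 (R : realType) (V W Z : weakSymplectic R)
    (L1 : set (V * W)) (L2 : set (W * Z))
    (L1_split : split_canonical_relation V W L1)
    (L2_split : split_canonical_relation W Z L2)
    (L12_neat : neatly_related V W Z L1 L2) :
  split_canonical_relation V Z (relation_comp L2 L1).
Proof.
pose Y := sum_weakSymplectic (opp_weakSymplectic V) Z.
pose U := sum_weakSymplectic (sum_weakSymplectic (opp_weakSymplectic V) W)
                             (sum_weakSymplectic (opp_weakSymplectic W) Z).
pose p (x : U) : Y := (x.1.1, x.2.2).
pose C : set U := [set x : (V * W) * (W * Z) | x.1.2 = x.2.1].
rewrite /split_canonical_relation.
suff -> : relation_comp L2 L1 = p @` ((L1 `*` L2 : set U) `&` C).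
  apply: neat_reduction L12_neat.
  - by [].
  - move=> [[v w] [w1 z]] [[v' w'] [w1' z']]; rewrite /C /= => <- <-.
    (* On [C] the two [W] terms carry opposite signs and cancel. *)
    by rewrite /sum_form /= /sum_form /= /opp_form /= addrA addrK.
  - apply/seteqP; split=> // -[v z] _.
    by exists ((v, 0), (0, z)).
  - move=> [[v w] [w1 z]] x_orth; congr pair; apply: ws_form_eq0 => a.
      (* Vectors supported on an outer coordinate lie in [C], so they test [v] and [z]
         separately. *)
      have := x_orth ((a, 0), (0, 0)) erefl.
      by rewrite /= /sum_form /= /sum_form /= /opp_form !linear0r oppr0 !addr0.
    have := x_orth ((0, 0), (0, a)) erefl.
    by rewrite /= /sum_form /= /sum_form /= /opp_form !linear0r oppr0 !add0r.
apply/seteqP; split=> [[v z] [w [L1w L2w]]|y [[[v w] [w1 z]] [[L1w L2w] ww1] <-]].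
  by exists ((v, w), (w, z)).
by exists w; split=> //=; rewrite (ww1 : w = w1).
Qed.
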